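(* Let $A$ be a unital $C^*$-algebra, and let $0\neq a\in A$ be an element that is not right invertible. Then $a$ is not an isolated point of the orthograph $\Gamma(A)$; that is, there is a nonzero $b\in A$ with $a\mathrel{\perp\!\!\!\!\perp}^S b$.
   Context: Let $A$ be a $C^*$-algebra. For $a,b\in A$, $a$ is strong $BJ$-orthogonal (strong Birkhoff-James orthogonal) to $b$, written $a\perp^S b$, if $\|a+bc\|\ge\|a\|$ for every $c\in A$. The elements $a,b$ are mutually strong $BJ$-orthogonal, written $a\mathrel{\perp\!\!\!\!\perp}^S b$, if $a\perp^S b$ and $b\perp^S a$. These relations do not change when $a$, $b$ are replaced by nonzero scalar multiples. The orthograph $\Gamma(A)$ is the graph whose vertex set is the projective space $S=(A\setminus\{0\})/(a\sim\lambda a,\ \lambda\in\mathbb C\setminus\{0\})$ and whose edges are the pairs $(a,b)\in S\times S$ with $a\mathrel{\perp\!\!\!\!\perp}^S b$. A nonzero element is identified with the vertex it represents. An isolated point (isolated vertex) is a vertex belonging to no edge. *)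

(* Defs.v *)
From HB Require Import structures.
From mathcomp Require Import all_boot all_order all_algebra generic_quotient.
From mathcomp Require Import complex.
From mathcomp Require Import all_classical all_reals all_analysis.

Set Implicit Arguments.
Unset Strict Implicit.
Unset Printing Implicit Defensive.

Import Order.TTheory GRing.Theory Num.Theory.
Import numFieldNormedType.Exports.

Local Open Scope ring_scope.
Local Open Scope quotient_scope.

(* GRing.Algebra cannot be joined with CompleteNormedModule (Num.NumDomain
   already inherits from the common ancestors without such a join), so the
   multiplication is a field of the mixin and the algType structure is derived
   from it below.
   Norms of elements of a normed module over R[i] are elements of R[i]; being
   nonnegative they are real, so that the partial order of R[i] restricts to
   the usual total order on them. *)
HB.mixin Record isCStarAlgebra (R : realType) (A : Type)
    of CompleteNormedModule R[i] A := {
  cstar_one : A;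
  cstar_mul : A -> A -> A;
  adjoint : A -> A;
  cstar_mulA : associative cstar_mul;
  cstar_mul1 : left_id cstar_one cstar_mul;
  cstar_mulr1 : right_id cstar_one cstar_mul;
  cstar_mulDl : left_distributive cstar_mul +%R;
  cstar_mulDr : right_distributive cstar_mul +%R;
  cstar_one_neq0 : cstar_one != 0;
  cstar_scaleAl : forall (l : R[i]) (a b : A),
    l *: cstar_mul a b = cstar_mul (l *: a) b;
  cstar_scaleAr : forall (l : R[i]) (a b : A),
    l *: cstar_mul a b = cstar_mul a (l *: b);
  adjointD : {morph adjoint : a b / a + b};
  adjointZ : forall (l : R[i]) (a : A), adjoint (l *: a) = l^* *: adjoint a;
  adjoint_mul : forall a b : A,
    adjoint (cstar_mul a b) = cstar_mul (adjoint b) (adjoint a);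
  adjointK : involutive adjoint;
  norm_mul_le : forall a b : A, `|cstar_mul a b| <= `|a| * `|b|;
  norm_adjoint_mul : forall a : A, `|cstar_mul (adjoint a) a| = `|a| ^+ 2
}.

(* Unital C*-algebras. The axiom cstar_one_neq0, required by algType, leaves
   out only the zero algebra, which has no nonzero element. *)
#[short(type="cstarAlgType")]
HB.structure Definition CStarAlgebra (R : realType) :=
  {A of isCStarAlgebra R A & CompleteNormedModule R[i] A}.

HB.instance Definition _ (R : realType) (A : cstarAlgType R) :=
  GRing.Zmodule_isNzRing.Build (CStarAlgebra.sort A)
    (@cstar_mulA R A) (@cstar_mul1 R A) (@cstar_mulr1 R A)
    (@cstar_mulDl R A) (@cstar_mulDr R A) (@cstar_one_neq0 R A).

HB.instance Definition _ (R : realType) (A : cstarAlgType R) :=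
  GRing.LSemiModule_isLSemiAlgebra.Build R[i] (CStarAlgebra.sort A)
    (@cstar_scaleAl R A).

HB.instance Definition _ (R : realType) (A : cstarAlgType R) :=
  GRing.LSemiAlgebra_isSemiAlgebra.Build R[i] (CStarAlgebra.sort A)
    (@cstar_scaleAr R A).

Definition strong_BJ_orthogonal (R : realType) (A : cstarAlgType R)
    (a b : A) : Prop :=
  forall c : A, `|a| <= `|a + b * c|.

Definition mutual_strong_BJ_orthogonal (R : realType) (A : cstarAlgType R)
    (a b : A) : Prop :=
  strong_BJ_orthogonal a b /\ strong_BJ_orthogonal b a.

Definition right_invertible (R : realType) (A : cstarAlgType R)
    (a : A) : Prop :=
  exists c : A, a * c = 1.

Definition nonzero_elt (R : realType) (A : cstarAlgType R) : Type :=
  {a : A | a != 0}.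

HB.instance Definition _ (R : realType) (A : cstarAlgType R) :=
  Choice.on (nonzero_elt A).

Definition scalar_multiple (R : realType) (A : cstarAlgType R) :
    rel (nonzero_elt A) :=
  fun a b => `[< exists2 l : R[i], l != 0 & sval a = l *: sval b >].

Lemma scalar_multiple_refl (R : realType) (A : cstarAlgType R) :
  reflexive (@scalar_multiple R A).
Proof. by move=> a; apply/asboolP; exists 1; rewrite ?oner_neq0 ?scale1r. Qed.

Lemma scalar_multiple_sym (R : realType) (A : cstarAlgType R) :
  symmetric (@scalar_multiple R A).
Proof.
suff sym a b : @scalar_multiple R A a b -> scalar_multiple b a.
  by move=> a b; apply/idP/idP; exact: sym.
move=> /asboolP[l l0 ab]; apply/asboolP; exists l^-1; first by rewrite invr_eq0.
by rewrite ab scalerA mulVf// scale1r.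
Qed.

Lemma scalar_multiple_trans (R : realType) (A : cstarAlgType R) :
  transitive (@scalar_multiple R A).
Proof.
move=> b a c /asboolP[l l0 ab] /asboolP[m m0 bc]; apply/asboolP.
by exists (l * m); rewrite ?mulf_neq0// ab bc scalerA.
Qed.

Canonical scalar_multiple_equiv (R : realType) (A : cstarAlgType R) :=
  EquivRel (@scalar_multiple R A) (@scalar_multiple_refl R A)
    (@scalar_multiple_sym R A) (@scalar_multiple_trans R A).

(* The projective space of A, i.e. the vertex set of the orthograph. *)
Definition projective_space (R : realType) (A : cstarAlgType R) :=
  {eq_quot (@scalar_multiple R A)}.

Definition vertex (R : realType) (A : cstarAlgType R) (a : A) (a0 : a != 0) :
    projective_space A :=
  \pi_{eq_quot (@scalar_multiple R A)} (exist _ a a0 : nonzero_elt A).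

Definition orthograph_edge (R : realType) (A : cstarAlgType R)
    (u v : projective_space A) : Prop :=
  exists (a b : A) (a0 : a != 0) (b0 : b != 0),
    [/\ u = vertex a0, v = vertex b0 & mutual_strong_BJ_orthogonal a b].

Definition isolated_vertex (R : realType) (A : cstarAlgType R)
    (u : projective_space A) : Prop :=
  ~ exists v : projective_space A, orthograph_edge u v \/ orthograph_edge v u.

(* Edges do not depend on the chosen representatives. *)
Lemma strong_BJ_orthogonalZ (R : realType) (A : cstarAlgType R)
    (l m : R[i]) (a b : A) : l != 0 -> m != 0 ->
  strong_BJ_orthogonal a b -> strong_BJ_orthogonal (l *: a) (m *: b).
Proof.
move=> l0 m0 ab c.
have -> : l *: a + m *: b * c = l *: (a + b * (l^-1 *: (m *: c))).
  by rewrite scalerDr -!scalerAr -scalerAl !scalerA mulrA mulfV// mul1r.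
by rewrite !normrZ ler_wpM2l.
Qed.

Lemma orthograph_edgeE (R : realType) (A : cstarAlgType R) (a b : A)
    (a0 : a != 0) (b0 : b != 0) :
  orthograph_edge (vertex a0) (vertex b0) <-> mutual_strong_BJ_orthogonal a b.
Proof.
split; last by exists a, b, a0, b0.
move=> [a' [b' [a'0 [b'0 [/eqmodP/asboolP[l l0 /= ->]]]]]].
move=> /eqmodP/asboolP[m m0 /= ->] [ab ba].
by split; exact: strong_BJ_orthogonalZ.
Qed.

(* Main.v *)
Require Import Defs.
From mathcomp Require Import all_boot all_order all_algebra.
From mathcomp Require Import all_classical all_reals all_analysis.
From mathcomp Require Import complex.

(** Rescale so that |a| = 1 and put h = a a*, a selfadjoint element of norm 1.
    Thought of as a function, h takes values in [-1, 1], its square reaches the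
    value 1, and h vanishes somewhere because a is not right invertible.
    The element orthogonal to a is
<<
      b = (1 - h^2) / (1 + h^2),
>>
    a function of h equal to 1 where h vanishes, to 0 where h^2 = 1, and of
    modulus at most 1 everywhere.  These three properties are turned into
    algebra: inverses come from the Neumann series, norm bounds from unitaries.

    The element b is orthogonal to a: since b = 1 - 2 h^2 / (1 + h^2) and h
    starts with the factor a, the element 1 - (b + a c) lies in a A.  If
    |b + a c| < 1 it would be invertible, and a would be right invertible.  So
    |b + a c| >= 1 >= |b|; the last inequality holds because b is the real part
    of the Cayley transform (1 + i h) / (1 - i h), which is unitary
    ([cayley_parts]).

    The element a is orthogonal to b: with x = a + b c,
<<
      1 - x a* h = 1 - h^2 - b c a* h = (1 - h^2) (1 - (1 + h^2)^-1 c a* h).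
>>
    If |x| < 1 the left side is invertible, so 1 - h^2 is right invertible.
    This is impossible as |h| = 1 ([selfadjoint_sub1_sqr_not_rinv]): the norm
    of h^2 belongs to its spectrum.  The quantity that refutes invertibility is
    h^2 / (1 - h^2), which is multiplied by h^2 / (1 + h^2), of norm at most
    1/2, when h is replaced by h^2.  Iterating the squaring makes it tend to 0,
    whereas it is bounded below for every selfadjoint h of norm 1. *)

Import Order.TTheory GRing.Theory Num.Theory.
Import numFieldNormedType.Exports.

Local Open Scope ring_scope.
Local Open Scope classical_set_scope.

(** Norms are complex numbers, and the limit theorem for geometric sequences is
    about real ones, hence the passage through real parts. *)
Lemma exprn_small (R : realType) (r e : R[i]) : 0 <= r -> r < 1 -> 0 < e ->
  exists N : nat, forall n : nat, (N <= n)%N -> r ^+ n < e.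
Proof.
move=> r0 r1 e0.
have rE := RRe_real (ger0_real r0); have eE := RRe_real (gtr0_real e0).
move: r0 r1 e0; rewrite -rE -eE ler0c !ltcR.
move: (complex.Re r) (complex.Re e) => s d s0 s1 d0.
have /cvgrPdist_lt/(_ d d0) [N _ Ns] : (GRing.exp s : R ^nat) @ \oo --> (0 : R).
  by apply: cvg_expr; rewrite ger0_norm.
exists N => n /Ns /=; rewrite sub0r normrN ger0_norm ?exprn_ge0//.
by rewrite -rmorphXn ltcR.
Qed.

(** * Norm and adjoint *)

Section CStar.
Context {R : realType} {A : cstarAlgType R}.
Implicit Types (a b c g h x y : A) (l : R[i]).

Lemma cstar_normM_le x y : `|x * y| <= `|x| * `|y|.
Proof. exact: norm_mul_le. Qed.

Lemma adjointM x y : adjoint (x * y) = adjoint y * adjoint x.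
Proof. exact: adjoint_mul. Qed.

Lemma cstar_identity x : `|adjoint x * x| = `|x| ^+ 2.
Proof. exact: norm_adjoint_mul. Qed.

Lemma adjoint1 : adjoint (1 : A) = 1.
Proof.
by rewrite -[LHS]mulr1 -{2}[1](@adjointK R A) -adjointM mulr1 adjointK.
Qed.

Lemma adjointN x : adjoint (- x) = - adjoint x.
Proof. by rewrite -scaleN1r adjointZ rmorphN1 scaleN1r. Qed.

Lemma adjointB x y : adjoint (x - y) = adjoint x - adjoint y.
Proof. by rewrite adjointD adjointN. Qed.

Lemma cstar_norm1 : `|1 : A| = 1.
Proof.
have := cstar_identity 1; rewrite adjoint1 mulr1 expr2 => /eqP.
rewrite eq_sym -subr_eq0 -[X in _ - X]mulr1 -mulrBr mulf_eq0 normr_eq0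
  oner_eq0 /=.
by rewrite subr_eq0 => /eqP.
Qed.

Lemma norm_adjoint x : `|adjoint x| = `|x|.
Proof.
have le y : `|y| <= `|adjoint y|.
  have [->|y0] := eqVneq y 0; first by rewrite normr0.
  by rewrite -(ler_pM2r (x := `|y|)) ?normr_gt0// -expr2 -cstar_identity
    cstar_normM_le.
by apply/le_anti; rewrite le andbT -{2}[x]adjointK le.
Qed.

Lemma cstar_normX_le x n : `|x ^+ n| <= `|x| ^+ n.
Proof.
elim: n => [|n IH]; first by rewrite !expr0 cstar_norm1.
by rewrite !exprS (le_trans (cstar_normM_le _ _))// ler_wpM2l.
Qed.

(** * Invertible elements *)

(** The Neumann series; its partial sums s_n satisfy
    (1 - x) s_n = 1 - x^n. *)
Lemma neumann_rinv x : `|x| < 1 -> exists y, (1 - x) * y = 1.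
Proof.
move=> x1; pose s n : A := \sum_(i < n) x ^+ i.
have d0 : 0 < 1 - `|x| by rewrite subr_gt0.
have sE n : (1 - x) * s n = 1 - x ^+ n.
  by rewrite -opprB mulNr -subrX1 opprB.
have s_le n : `|s n| <= (1 - `|x|)^-1.
  have : `|s n| <= \sum_(i < n) `|x| ^+ i.
    apply: le_trans (ler_norm_sum _ _ _) _; apply: ler_sum => i _.
    exact: cstar_normX_le.
  move/le_trans; apply; rewrite -(ler_pM2l d0) mulfV ?gt_eqF//.
  by rewrite -opprB mulNr -subrX1 opprB lerBlDr lerDl exprn_ge0.
have sD N n : s (N + n)%N = s N + x ^+ N * s n.
  rewrite /s big_split_ord /= mulr_sumr; congr (_ + _).
  by apply: eq_bigr => i _; rewrite exprD.
have /cauchy_cvgP s_cvg : cauchy (s @ \oo).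
  apply: cauchy_exP => e e0.
  (* All s_n with n >= N lie within |x|^N / (1 - |x|) of s_N. *)
  have [N HN] := @exprn_small R `|x| (e * (1 - `|x|)) (normr_ge0 _) x1
    (mulr_gt0 e0 d0).
  exists (s N), N => // n /= Nn.
  rewrite -ball_normE /= distrC -(subnKC Nn) sD addrC addKr.
  apply: le_lt_trans (cstar_normM_le _ _) _.
  apply: (@le_lt_trans _ _ (`|x| ^+ N * (1 - `|x|)^-1)).
    by apply: ler_pM; rewrite ?cstar_normX_le.
  by rewrite ltr_pdivrMr// HN.
pose y := lim (s @ \oo); exists y; apply/eqP; rewrite -subr_eq0 -normr_eq0.
rewrite eq_le normr_ge0 andbT; apply/ler_addgt0Pr => e e0; rewrite add0r.
set K := `|1 - x| + 1.
have K0 : 0 < K by rewrite ltr_wpDl.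
have [N HN] := @exprn_small R `|x| (e / 2) (normr_ge0 _) x1
  (divr_gt0 e0 (ltr0n _ 2)).
move/cvgrPdist_lt: s_cvg => /(_ (e / 2 / K)).
rewrite divr_gt0 ?divr_gt0// => /(_ isT) [M _ HM].
have {HM} := HM (maxn M N) (leq_maxl _ _).
set n := maxn M N => /= yn.
have -> : (1 - x) * y - 1 = (1 - x) * (y - s n) - x ^+ n.
  by rewrite mulrBr sE opprB addrA addrAC addrK.
apply: le_trans (ler_normB _ _) _; rewrite [leRHS]splitr lerD//.
  apply: le_trans (cstar_normM_le _ _) _.
  apply: (@le_trans _ _ (K * (e / 2 / K))); last by rewrite mulrC divfK ?gt_eqF.
  by rewrite ler_pM// ?lerDl// ltW.
by apply: le_trans (cstar_normX_le _ _) _; apply/ltW/HN; exact: leq_maxr.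
Qed.

(** Taking adjoints turns a right inverse of x into a left one. *)
Lemma selfadjoint_rinv x y : adjoint x = x -> x * y = 1 ->
  adjoint y = y /\ y * x = 1.
Proof.
move=> xsa xy.
have yx : adjoint y * x = 1 by rewrite -{1}xsa -adjointM xy adjoint1.
have ysa : adjoint y = y by rewrite -[LHS]mulr1 -xy mulrA yx mul1r.
by split=> //; rewrite -{1}ysa.
Qed.

Lemma norm_selfadjoint_sqr x : adjoint x = x -> `|x ^+ 2| = `|x| ^+ 2.
Proof. by move=> xsa; rewrite -cstar_identity xsa expr2. Qed.

(** The hypotheses say that c + i s is unitary, hence so is its adjoint c - i s;
    c and s are half the sum and half the difference of the two, up to a factor
    of modulus 1. *)
Lemma norm_unitary_parts_le1 c s : adjoint c = c -> adjoint s = s ->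
  c * s = s * c -> c ^+ 2 + s ^+ 2 = 1 -> `|c| <= 1 /\ `|s| <= 1.
Proof.
move=> csa ssa cs cs1; pose i : R[i] := 'i.
have ii : i * i = -1 by rewrite -expr2 sqrCi.
pose u t := c + t *: s.
have uadj t : adjoint (u t) = u t^*%R by rewrite adjointD adjointZ csa ssa.
have uu t : t * t = -1 -> u (- t) * u t = 1.
  move=> tt; rewrite /u mulrDl !mulrDr -!scalerAl -!scalerAr scalerA mulNr tt
    opprK.
  by rewrite scale1r -cs scaleNr addrA addrK -!expr2.
have u1 t : t * t = -1 -> t^*%R = - t -> `|u t| = 1.
  move=> tt tj; have := cstar_identity (u t).
  rewrite uadj tj uu// cstar_norm1 => /esym/eqP; rewrite sqrf_eq1.
  move=> /orP[/eqP//|/eqP uN].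
  by have := normr_ge0 (u t); rewrite uN oppr_ge0 ler10.
have uP : `|u i| = 1 by apply: u1; rewrite // /i conjCi.
have uM : `|u (- i)| = 1 by apply: u1; rewrite ?mulrNN // /i rmorphN /= conjCi.
have n2 : `|2 : R[i]| = 2 by rewrite ger0_norm.
have half x y : `|x| = 1 -> `|y| = 1 -> `|x + y| <= 2.
  by move=> x1 y1; rewrite (le_trans (ler_normD _ _))// x1 y1.
split.
- have : `|u i + u (- i)| <= 2 by apply: half.
  rewrite /u addrACA scaleNr subrr addr0 -mulr2n -scaler_nat normrZ n2.
  by rewrite -[leRHS]mulr1 ler_pM2l.
- have : `|u i + (- u (- i))| <= 2 by apply: half; rewrite ?normrN.
  rewrite /u opprD addrACA subrr add0r scaleNr opprK -mulr2n -scaler_nat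
    !normrZ n2.
  by rewrite /i normCi mul1r -[leRHS]mulr1 ler_pM2l.
Qed.

(** Factor 1 + h^2 = (1 + i h) (1 - i h).  As i h may have
    norm 1, the factor 1 + i h is compared with 2 instead of 1:
    |1 - i h|^2 = |1 + h^2| <= 2 by the C*-identity, so
    (1 + i h) / 2 = 1 - (1 - i h) / 2 is within distance sqrt 2 / 2 < 1 of 1
    and the Neumann series inverts it. *)
Lemma selfadjoint_add1_sqr_rinv h : adjoint h = h -> `|h| <= 1 ->
  exists g, adjoint g = g /\ (1 + h ^+ 2) * g = 1.
Proof.
move=> hsa h1; pose p (t : R[i]) := 1 + t *: h.
have pp t : t * t = -1 -> p t * p (- t) = 1 + h ^+ 2.
  move=> tt; rewrite /p mulrDl mul1r mulrDr mulr1 -!scalerAl -!scalerAr scalerA.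
  by rewrite mulrN tt opprK scale1r scaleNr addrA subrK -expr2.
have nle : `|1 + h ^+ 2| <= 2.
  apply: le_trans (ler_normD _ _) _; rewrite cstar_norm1 norm_selfadjoint_sqr//.
  by rewrite lerD2l exprn_ile1.
have prinv t : t * t = -1 -> t^*%R = - t -> exists y, p t * y = 1.
  move=> tt tj.
  have padj : adjoint (p (- t)) = p t.
    by rewrite adjointD adjoint1 adjointZ hsa rmorphN /= tj opprK.
  have n2 : `|p (- t)| ^+ 2 <= 2.
    by rewrite -cstar_identity padj pp.
  have pE : 1 - 2^-1 *: p (- t) = 2^-1 *: p t.
    have -> : (1 : A) = 2^-1 *: (1 + 1).
      by rewrite -[1 + 1]mulr2n -(scaler_nat 2 (1 : A)) scalerA mulVf
        ?pnatr_eq0// scale1r.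
    by rewrite -scalerBr /p opprD addrACA subrr add0r scaleNr opprK.
  have [|y] := neumann_rinv (2^-1 *: p (- t)).
    rewrite -(@ltr_pXn2r _ 2) ?nnegrE// expr1n normrZ exprMn.
    apply: (@le_lt_trans _ _ (`|2^-1 : R[i]| ^+ 2 * 2)).
      by rewrite ler_wpM2l.
    rewrite ger0_norm ?invr_ge0// expr2 mulfVK ?pnatr_eq0//.
    by rewrite invf_lt1 ?ltr1n.
  by rewrite pE -scalerAl scalerAr => py; exists (2^-1 *: y).
have [y py] : exists y, p 'i * y = 1.
  by apply: prinv; rewrite ?conjCi// -expr2 sqrCi.
have [z pz] : exists z, p (- 'i) * z = 1.
  by apply: prinv; rewrite ?rmorphN /= ?conjCi// mulrNN -expr2 sqrCi.
have hg : (1 + h ^+ 2) * (z * y) = 1.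
  by rewrite -(@pp 'i) -?expr2 ?sqrCi// mulrA -(mulrA (p 'i)) pz mulr1.
exists (z * y); split=> //.
have sa : adjoint (1 + h ^+ 2) = 1 + h ^+ 2.
  by rewrite adjointD adjoint1 adjointM hsa -expr2.
by have [] := selfadjoint_rinv _ _ sa hg.
Qed.

(** * Bounds from the Cayley transform *)

(** With g = (1 + h^2)^-1, the elements (1 - h^2) g and 2 h g are the real and
    imaginary parts of the unitary (1 + i h) / (1 - i h): the identity
    (1 - h^2)^2 + (2 h)^2 = (1 + h^2)^2 makes their squares add up to 1.  The
    computation uses (1 - h^2) g = 2 g - 1, linear in g. *)
Lemma cayley_parts h g : adjoint h = h -> adjoint g = g ->
  (1 + h ^+ 2) * g = 1 ->
  [/\ h * g = g * h, (1 - h ^+ 2) * g = 1 - (h ^+ 2 * g) *+ 2,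
    `|(1 - h ^+ 2) * g| <= 1 & `|(h * g) *+ 2| <= 1].
Proof.
move=> hsa gsa hg.
have sa : adjoint (1 + h ^+ 2) = 1 + h ^+ 2.
  by rewrite adjointD adjoint1 adjointM hsa -expr2.
have [_ gh] := selfadjoint_rinv _ _ sa hg.
have com : h * g = g * h.
  have com' : h * (1 + h ^+ 2) = (1 + h ^+ 2) * h.
    by rewrite mulrDr mulrDl mulr1 mul1r -exprS -exprSr.
  by rewrite -[LHS]mul1r -gh -mulrA [X in g * X]mulrA -com' -!mulrA hg mulr1.
have h2g : h ^+ 2 * g = 1 - g by rewrite -hg mulrDl mul1r addrC addKr.
have cE : (1 - h ^+ 2) * g = g *+ 2 - 1.
  by rewrite mulrBl mul1r h2g opprB addrA mulr2n.
have adj2 x : adjoint (x *+ 2) = adjoint x *+ 2 by rewrite !mulr2n adjointD.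
have := norm_unitary_parts_le1 (g *+ 2 - 1) ((h * g) *+ 2).
have s2 : ((h * g) *+ 2) ^+ 2 = g *+ 2 *+ 2 - (g *+ 2) ^+ 2.
  have hG : h * (g *+ 2) = (g *+ 2) * h by rewrite mulrnAr mulrnAl com.
  rewrite -mulrnAr expr2 {1}hG -mulrA (mulrA h h) -expr2 mulrnAr h2g mulrnBl.
  by rewrite mulrBr mulrnAr mulr1 -expr2.
case.
- by rewrite adjointB adj2 adjoint1 gsa.
- by rewrite adj2 adjointM gsa hsa com.
- have ghg : GRing.comm (h * g) g by rewrite /GRing.comm mulrA -com.
  by apply/commrMn/commr_sym/commrB; [exact: commrMn | exact: commr1].
- by rewrite s2 sqrrB1 -[_ ^+ 2 - _]opprB addrC addrA subrr add0r.
move=> c1 s1; split=> //; last by rewrite cE.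
by rewrite cE h2g mulrnBl opprB (mulr2n (1 : A)) opprD addrCA [1 + _]addrA
  subrr add0r.
Qed.

(** * The norm of a selfadjoint element is seen by its spectrum *)

(** Here y = (1 - h^2)^-1.  For n = 0, h^2 = (h^2 y) (1 - h^2) and
    |1 - h^2| <= 2 give 1 <= 2 |h^2 y|.  Passing from h to h^2 replaces y by
    (1 - h^4)^-1 = (1 + h^2)^-1 y, and
    h^4 (1 + h^2)^-1 y = (h^2 (1 + h^2)^-1) (h^2 y), where the first factor has
    norm at most |h| / 2 by the bound on the imaginary part of the Cayley
    transform.  So each squaring doubles the lower bound on |h^2 y|. *)
Lemma selfadjoint_sub1_sqr_growth h y n : adjoint h = h -> `|h| = 1 ->
  (1 - h ^+ 2) * y = 1 -> 2 ^+ n <= 2 * `|h ^+ 2 * y|.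
Proof.
elim: n h y => [|n IH] h y hsa h1 hy.
  have sa : adjoint (1 - h ^+ 2) = 1 - h ^+ 2.
    by rewrite adjointB adjoint1 adjointM hsa -expr2.
  have [_ yh] := selfadjoint_rinv _ _ sa hy.
  rewrite expr0 -[X in X <= _](expr1n _ 2) -h1 -norm_selfadjoint_sqr//.
  rewrite -[X in `|X| <= _]mulr1 -yh mulrA mulrC.
  apply: le_trans (cstar_normM_le _ _) _; apply: ler_wpM2l => //.
  apply: le_trans (ler_normB _ _) _.
  by rewrite cstar_norm1 norm_selfadjoint_sqr// h1 expr1n.
have [g [gsa hg]] : exists g, adjoint g = g /\ (1 + h ^+ 2) * g = 1.
  by apply: selfadjoint_add1_sqr_rinv; rewrite ?h1.
have [com _ _ bnd] := cayley_parts h g hsa gsa hg.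
have h2sa : adjoint (h ^+ 2) = h ^+ 2 by rewrite adjointM hsa.
have inv4 : (1 - (h ^+ 2) ^+ 2) * (g * y) = 1.
  have -> : 1 - (h ^+ 2) ^+ 2 = (1 - h ^+ 2) * (1 + h ^+ 2).
    by rewrite mulrBl mul1r mulrDr mulr1 -expr2 opprD addrA addrK.
  by rewrite mulrA -(mulrA (1 - _)) hg mulr1.
have split4 : ((h ^+ 2) ^+ 2 * (g * y)) *+ 2 =
    h * ((h * g) *+ 2) * (h ^+ 2 * y).
  have h2g : h ^+ 2 * g = g * h ^+ 2.
    by rewrite expr2 -mulrA com mulrA com mulrA.
  rewrite mulrnAr mulrnAl [h * (h * g)]mulrA -expr2 [(h ^+ 2) ^+ 2]expr2.
  rewrite -(mulrA (h ^+ 2) (h ^+ 2)) (mulrA (h ^+ 2) g y).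
  by rewrite {1}h2g -(mulrA g) mulrA.
have := IH (h ^+ 2) (g * y) h2sa.
rewrite norm_selfadjoint_sqr// h1 expr1n => /(_ erefl inv4) le_n.
rewrite exprS ler_wpM2l//; apply: le_trans le_n _.
rewrite mulr_natl -normrMn split4.
apply: le_trans (cstar_normM_le _ _) _; rewrite -[leRHS]mul1r ler_wpM2r//.
by apply: le_trans (cstar_normM_le _ _) _; rewrite h1 mul1r.
Qed.

(** Otherwise the fixed number 2 |h^2 y| would exceed all powers of 2. *)
Lemma selfadjoint_sub1_sqr_not_rinv h y : adjoint h = h -> `|h| = 1 ->
  (1 - h ^+ 2) * y <> 1.
Proof.
move=> hsa h1 hy; set r := 2 * `|h ^+ 2 * y|.
have le n : 2 ^+ n <= r by apply: selfadjoint_sub1_sqr_growth.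
have r0 : 0 < r by rewrite (lt_le_trans _ (le 0%N)).
have [|||N /(_ N (leqnn _))] := @exprn_small R 2^-1 r^-1.
- by rewrite invr_ge0.
- by rewrite invf_lt1 ?ltr1n.
- by rewrite invr_gt0.
rewrite exprVn ltf_pV2 ?posrE ?exprn_gt0// => /(le_lt_trans (le N)).
by rewrite ltxx.
Qed.

(** * Mutual orthogonality *)

Lemma unit_norm_orthogonal a : `|a| = 1 -> ~ right_invertible a ->
  exists b, b != 0 /\ mutual_strong_BJ_orthogonal a b.
Proof.
move=> a1 ninv; pose h := a * adjoint a.
have hsa : adjoint h = h by rewrite adjointM adjointK.
have h1 : `|h| = 1.
  by rewrite /h -{1}(adjointK a) cstar_identity norm_adjoint a1 expr1n.
have [g [gsa hg]] : exists g, adjoint g = g /\ (1 + h ^+ 2) * g = 1.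
  by apply: selfadjoint_add1_sqr_rinv; rewrite ?h1.
have [_ bE b_le _] := cayley_parts h g hsa gsa hg.
pose b := (1 - h ^+ 2) * g.
have not_lt1 x : (`|x| < 1 -> False) -> 1 <= `|x|.
  by move=> lt1; rewrite real_leNgt ?normr_real ?real1//; apply/negP.
have ba c : 1 <= `|b + a * c|.
  apply: not_lt1 => /neumann_rinv[y].
  (* Both terms of b - 1 + a c have a as left factor. *)
  have -> : 1 - (b + a * c) = a * ((adjoint a * h * g) *+ 2 - c).
    by rewrite /b bE mulrBr mulrnAr opprD opprB addrA addrCA subrr addr0 expr2
      /h !mulrA.
  by rewrite -(mulrA a) => ay; apply: ninv; eexists; exact: ay.
exists b; split.
  apply/eqP => b0; have := ba 0.
  by rewrite b0 mulr0 addr0 normr0 ler10.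
split=> c; last exact: le_trans b_le (ba c).
rewrite a1; apply: not_lt1 => x1; pose x := a + b * c.
have [|y] := neumann_rinv (x * adjoint a * h).
  apply: le_lt_trans (cstar_normM_le _ _) _; rewrite h1 mulr1.
  by apply: le_lt_trans (cstar_normM_le _ _) _; rewrite norm_adjoint a1 mulr1.
have -> : 1 - x * adjoint a * h = (1 - h ^+ 2) * (1 - g * c * adjoint a * h).
  by rewrite mulrBr mulr1 !(mulrA (1 - h ^+ 2)) -/b /x mulrDl [X in 1 - X]mulrDl
    opprD addrA -/h -expr2.
by rewrite -(mulrA (1 - h ^+ 2)); exact: selfadjoint_sub1_sqr_not_rinv.
Qed.

End CStar.

Theorem proposition2p4 (R : realType) (A : cstarAlgType R) (a : A)
    (a_neq0 : a != 0) (a_not_rinv : ~ right_invertible a) :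
  ~ isolated_vertex (vertex a_neq0) /\
  (exists b : A, b != 0 /\ mutual_strong_BJ_orthogonal a b).
Proof.
have na0 : `|a| != 0 by rewrite normr_eq0.
have [b [b0 [ab ba]]] : exists b : A, b != 0 /\ mutual_strong_BJ_orthogonal a b.
  have [||b [b0 [ab ba]]] := @unit_norm_orthogonal R A (`|a|^-1 *: a).
  - by rewrite normrZ normfV normr_id mulVf.
  - move=> [c ac]; apply: a_not_rinv; exists (`|a|^-1 *: c).
    by rewrite -scalerAr scalerAl.
  have aE : a = `|a| *: (`|a|^-1 *: a) by rewrite scalerA mulfV// scale1r.
  exists b; split=> //; rewrite aE -[b]scale1r.
  by split; apply: strong_BJ_orthogonalZ; rewrite ?oner_neq0.
split; last by exists b.
apply; exists (vertex b0); left.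
exact/orthograph_edgeE.
Qed.
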